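(* Suppose an algorithm $\mathcal A$ satisfies conditions (1)–(4) of the context for a one-dimensional online linear optimization game with domain $[-1,1]$. Then for all even $T\ge2$ there exist a sequence of costs $g_1,\dots,g_T\in\mathbb{R}$ with $|g_t|=1$ for all $t$ and a comparator sequence $u_1,\dots,u_T\in[-1,1]$ such that the path length satisfies $P=\sum_{t=1}^{T-1}|u_t-u_{t+1}|\le2$, but the regret satisfies $$\sum_{t=1}^T g_t(w_t-u_t)\ge\frac T2,$$ where $w_1,\dots,w_T\in[-1,1]$ are the outputs of $\mathcal A$ on $g_1,\dots,g_T$.
   Context: A one-dimensional online linear optimization algorithm with domain $[-1,1]$ outputs $w_t\in[-1,1]$ in round $t$ and then receives $g_t\in\mathbb{R}$. Write $g_{1:t}=\sum_{i=1}^t g_i$. Conditions on the algorithm: (1) $w_{t+1}=F_t(g_{1:t},|g_1|,\dots,|g_t|)$ for some functions $F_t$ (below, the dependence on $|g_1|,\dots,|g_t|$ is suppressed and these values are held fixed); for the first round, the sum is empty and $w_1=0$. (2) $\mathrm{sign}(F_t(g_{1:t}))=-\mathrm{sign}(g_{1:t})$ (with $\mathrm{sign}(0)=0$). (3) $F_t$ is odd in its first argument: $F_t(g_{1:t})=-F_t(-g_{1:t})$. (4) $x\mapsto F_t(-x)$ is non-decreasing for positive $x$. *)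

(* Defs.v *)
From mathcomp Require Import all_boot all_order all_algebra.
From mathcomp Require Import reals.

Set Implicit Arguments.
Unset Strict Implicit.
Unset Printing Implicit Defensive.

Import Order.TTheory GRing.Theory Num.Theory.
Local Open Scope ring_scope.

(* A deterministic algorithm with domain [-1, 1]: it maps the list
   [:: g_1; ..; g_t] of the costs revealed so far to the next output w_{t+1}. *)
Record olo_algorithm (R : realType) := OloAlgorithm {
  next_output :> seq R -> R;
  next_output_domain : forall h : seq R, -1 <= next_output h <= 1
}.

(* Rounds are numbered from 1; only g 1, .., g t.-1 are used at round t. *)
Definition output (R : realType) (A : olo_algorithm R) (g : nat -> R)
    (t : nat) : R :=
  A [seq g i | i <- iota 1 t.-1].

Definition path_length (R : realType) (T : nat) (u : nat -> R) : R :=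
  \sum_(1 <= t < T) `|u t - u t.+1|.

Definition regret (R : realType) (A : olo_algorithm R) (T : nat)
    (g u : nat -> R) : R :=
  \sum_(1 <= t < T.+1) g t * (output A g t - u t).

Definition cost_sum (R : realType) (h : seq R) : R := \sum_(x <- h) x.

Definition magnitudes (R : realType) (h : seq R) : seq R :=
  [seq `|x| | x <- h].

(* In the conditions below, F t s a stands for F_t(s, a_1, .., a_t). It is only
   ever constrained at lists a = [:: |g_1|; ..; |g_t|] of length t. *)
Definition depends_on_sum_and_magnitudes (R : realType) (A : olo_algorithm R)
    (F : nat -> R -> seq R -> R) : Prop :=
  A [::] = 0 /\
  forall h : seq R, A h = F (size h) (cost_sum h) (magnitudes h).

Definition opposes_sum_sign (R : realType) (F : nat -> R -> seq R -> R) : Prop :=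
  forall h : seq R,
    Num.sg (F (size h) (cost_sum h) (magnitudes h)) = - Num.sg (cost_sum h).

Definition odd_in_sum (R : realType) (F : nat -> R -> seq R -> R) : Prop :=
  forall h : seq R,
    F (size h) (cost_sum h) (magnitudes h) =
    - F (size h) (- cost_sum h) (magnitudes h).

(* The magnitudes stay fixed while x varies over all positive reals. *)
Definition monotone_in_sum (R : realType) (F : nat -> R -> seq R -> R) : Prop :=
  forall (h : seq R) (x y : R), 0 < x -> x <= y ->
    F (size h) (- x) (magnitudes h) <= F (size h) (- y) (magnitudes h).

(* Main.v *)
(* Play +1 in the first half of the rounds and -1 in the second, against the
   comparator that switches once from -1 to 1, so that [g_t u_t = -1] always.
   In the first half a round costs regret [w_t + 1 >= 0]; in the second half the
   partial sums of the costs are still positive, so [w_t <= 0] by the sign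
   condition and a round costs [1 - w_t >= 1]. *)
Require Import Defs.
From mathcomp Require Import all_boot all_order all_algebra.
From mathcomp Require Import reals.

Set Implicit Arguments.
Unset Strict Implicit.
Unset Printing Implicit Defensive.

Import Order.TTheory GRing.Theory Num.Theory.
Local Open Scope ring_scope.

Definition switch_cost (R : realType) (m t : nat) : R :=
  if (t <= m)%N then 1 else -1.

Lemma sum_switch (R : realType) (f : nat -> R) (a b : R) (m n : nat) :
  (m <= n)%N ->
  (forall t, (1 <= t <= m)%N -> f t = a) ->
  (forall t, (m < t <= n)%N -> f t = b) ->
  \sum_(1 <= t < n.+1) f t = a *+ m + b *+ (n - m).
Proof.
move=> le_mn fa fb; rewrite (big_cat_nat (n := m.+1)) //=.
rewrite (@eq_big_nat _ _ _ 1 m.+1 f (fun=> a) fa).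
rewrite (@eq_big_nat _ _ _ m.+1 n.+1 f (fun=> b) fb).
by rewrite !sumr_const_nat !subSS subn0.
Qed.

(** A cost -1 occurs only after all [m] costs +1 have been played, and [n <= m.*2] leaves room for
    at most [m] of them. *)
Lemma cost_sum_switch_ge0 (R : realType) (m n : nat) :
  (n <= m.*2)%N ->
  0 <= cost_sum [seq switch_cost R m i | i <- iota 1 n].
Proof.
move=> le_n2m; rewrite /cost_sum big_map.
have -> : iota 1 n = index_iota 1 n.+1 by rewrite /index_iota subSS subn0.
(* Before the switch every term is +1; from it on, the sum is [m - (n - m)]. *)
have [le_mn | /ltnW le_nm] := leqP m n; last first.
  rewrite big_nat_cond; apply: sumr_ge0 => i /andP[/andP[_ le_in] _].
  by rewrite /switch_cost (@leq_trans n i m le_in le_nm).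
rewrite (sum_switch (a := 1) (b := -1) le_mn).
- by rewrite mulNrn subr_ge0 ler_nat leq_subLR addnn.
- by move=> t /andP[_ le_tm]; rewrite /switch_cost le_tm.
- by move=> t /andP[lt_mt _]; rewrite /switch_cost leqNgt lt_mt.
Qed.

(** The comparator moves only between rounds [m] and [m.+1], by exactly 2; if that step lies outside
    the range, the length is 0. *)
Lemma path_length_switch (R : realType) (m T : nat) :
  path_length T (fun t => - switch_cost R m t) <= 2.
Proof.
have jump t : `|- switch_cost R m t - - switch_cost R m t.+1|
            = if t == m then 2 else 0.
  rewrite /switch_cost; case: (ltngtP t m) => _.
  - by rewrite subrr normr0.
  - by rewrite subrr normr0.
  - by rewrite opprK -opprD normrN (normr_nat _ 2).
rewrite /path_length (eq_bigr _ (fun t _ => jump t)) -big_mkcond /=.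
by rewrite big_nat1_eq; case: ifP.
Qed.

Lemma output_le0 (R : realType) (A : olo_algorithm R)
    (F : nat -> R -> seq R -> R) (g : nat -> R) (t : nat) :
  depends_on_sum_and_magnitudes A F -> opposes_sum_sign F ->
  0 <= cost_sum [seq g i | i <- iota 1 t.-1] -> output A g t <= 0.
Proof.
move=> [_ AE] signF sum_ge0.
by rewrite /output AE -sgr_le0 signF oppr_le0 sgr_ge0.
Qed.

Theorem theorem2 (R : realType) (A : olo_algorithm R)
    (F : nat -> R -> seq R -> R)
    (cond1 : depends_on_sum_and_magnitudes A F)
    (cond2 : opposes_sum_sign F)
    (cond3 : odd_in_sum F)
    (cond4 : monotone_in_sum F)
    (T : nat) (T_even : ~~ odd T) (T_ge2 : (2 <= T)%N) :
  exists g u : nat -> R,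
    [/\ forall t : nat, (1 <= t <= T)%N -> `|g t| = 1,
        forall t : nat, (1 <= t <= T)%N -> -1 <= u t <= 1,
        path_length T u <= 2
      & T%:R / 2 <= regret A T g u].
Proof.
pose m := T./2.
have TE : T = m.*2 by rewrite -[LHS]odd_double_half (negPf T_even).
pose g := switch_cost R m; pose u t := - g t.
have g_norm t : `|g t| = 1.
  by rewrite /g /switch_cost; case: ifP; rewrite ?normrN normr1.
exists g, u; split=> [t _ | t _ | |].
- exact: g_norm.
- by rewrite -ler_norml normrN g_norm.
- exact: path_length_switch.
(* [b t] is a lower bound for the regret of round [t]; the [T - m = m] rounds of the second half sum
   to [T / 2]. *)
pose b t : R := if (t <= m)%N then 0 else 1.
have -> : T%:R / 2 = \sum_(1 <= t < T.+1) b t.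
  rewrite (@sum_switch _ b 0 1 m T).
  - rewrite mul0rn add0r TE -addnn addnK natrD -mulr2n -[_ *+ 2]mulr_natr.
    by rewrite mulfK ?pnatr_eq0.
  - by rewrite TE -addnn leq_addr.
  - by move=> t /andP[_ le_tm]; rewrite /b le_tm.
  - by move=> t /andP[lt_mt _]; rewrite /b leqNgt lt_mt.
rewrite /regret; apply: ler_sum_nat => t /andP[_ lt_tT].
(* The domain bound [-1 <= w_t] settles the first half, the sign bound [w_t <= 0] the second. *)
have /andP[w_ge _] := next_output_domain A [seq g i | i <- iota 1 t.-1].
rewrite -/(output A g t) in w_ge.
have w_le0 : output A g t <= 0.
  apply: output_le0 cond1 cond2 _; apply: cost_sum_switch_ge0.
  (* The output of round [t] sees only [t.-1] costs, which is at most [T = m.*2]. *)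
  by rewrite -TE; exact: (@leq_trans t _ T (leq_pred t) lt_tT).
rewrite /u /b /g /switch_cost -/g; case: ifP => _.
  by rewrite mul1r opprK -lerBlDr sub0r.
by rewrite mulN1r opprK opprB lerDl oppr_ge0.
Qed.
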